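(* Let $K\in\mathcal K$. Suppose there exists $x\in\mathbb R^d$ such that (i) for every $y\in\mathbb R^d$ with $y-c_0(x)\mathbf 1_1\in K^0_0$, either $y-x\in K^0_0$ or $\mathbb P[y-x\in K_1]<1$; (ii) $x-c_0(x)\mathbf 1_1\notin K_0$. Then there exists $\vartheta\in L^0(\mathbb R^d;\mathbb F)$ such that $\Theta(\vartheta;K)\ne\Gamma(\vartheta;K)$.
   Context: Setting: $\mathbb T=\{0,\dots,T\}$ with an integer $T\ge1$; $(\Omega,\mathcal F,\mathbb P)$ is a complete probability space with filtration $\mathbb F=(\mathcal F_t)_{t\in\mathbb T}$, $\mathcal F_T=\mathcal F$, $\mathcal F_0$ trivial; $d\ge1$ is an integer. Relations between random variables (equality, inequality, membership in random sets) are understood $\mathbb P$-a.s.; since $\mathcal F_0$ is trivial, $K_0$ is deterministic. $L^0(\mathbb R^d;\mathbb F)$ is the set of $\mathbb R^d$-valued $\mathbb F$-adapted processes indexed by $\mathbb T$; $\cdot$ is the scalar product of $\mathbb R^d$; $\mathbf 1_1=(1,0,\dots,0)\in\mathbb R^d$. A $\mathcal C$-valued process is a sequence $K=(K_t)_{t\in\mathbb T}$ of set-valued maps for which there is a countable sequence of $\mathbb R^d$-valued $\mathbb F$-adapted processes $X^n=(X^n_t)_{t\in\mathbb T}$ such that, for every $t\in\mathbb T$, $\mathbb P$-a.s. only a finite but non-zero number of the $X^n_t$ are different from zero, and $K_t=\mathrm{cone}\{X^n_t: n\in\mathbb N\}$ (the polyhedral convex cone generated by them). $\mathcal K$ is the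 set of $\mathcal C$-valued processes $K$ with $\mathbb R^d_+\setminus\{0\}\subset\mathrm{int}(K_t)$ for all $t\in\mathbb T$. Notation: $K^0_t=K_t\cap(-K_t)$; $K^*_t(\omega)=\{y\in\mathbb R^d: x\cdot y\ge0\ \forall x\in K_t(\omega)\}$; $c_t(x)=\min\{c\in\mathbb R: c\mathbf 1_1-x\in K_t\}$ for $x\in\mathbb R^d$. $\mathcal A(K)=\{\xi\in L^0(\mathbb R^d;\mathbb F):\xi_t\in -K_t\ \forall t\in\mathbb T\}$; $V^{x,\xi}_t=x+\sum_{s=0}^t\xi_s$; $A(x;K)=\{V^{x,\xi}:\xi\in\mathcal A(K)\}$; $A^s(x;K)=\{\vartheta\in L^0(\mathbb R^d;\mathbb F): \exists V\in A(x;K)\text{ with }V_t-\vartheta_t\in K_t\ \forall t\in\mathbb T\}$; $\Gamma(\vartheta;K)=\{x\in\mathbb R^d:\vartheta\in A^s(x;K)\}$. $\mathcal Z(K)$ is the set of $(\mathbb F,\mathbb P)$-martingales $Z$ with $Z_t\in K^*_t$ for all $t\in\mathbb T$; $\mathcal T(\mathbb T)$ is the set of $\mathbb F$-stopping times with values in $\mathbb T$; and $$\Theta(\vartheta;K)=\Big\{x\in\mathbb R^d:\ \sup_{\tau\in\mathcal T(\mathbb T)}\mathbb E[Z_\tau\cdot\vartheta_\tau-Z_0\cdot x]\le0\ \text{ for all }Z\in\mathcal Z(K)\Big\}.$$ *)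

(* Defs.v *)
From HB Require Import structures.
From mathcomp Require Import all_boot all_order all_algebra.
From mathcomp Require Import all_classical all_reals all_analysis.

Set Implicit Arguments.
Unset Strict Implicit.
Unset Printing Implicit Defensive.

Import Order.TTheory GRing.Theory Num.Theory.
Import numFieldNormedType.Exports.

Local Open Scope classical_set_scope.
Local Open Scope ring_scope.

(** Row vectors ['rV[R]_d] represent R^d and ['I_T.+1] is the set of times
    {0, ..., T}.  Processes are functions of time and scenario; (in)equalities
    and memberships between random objects are read P-almost surely. *)

Definition dotv (R : realType) (d : nat) (x y : 'rV[R]_d) : R :=
  \sum_(i < d) x 0 i * y 0 i.

(* (1, 0, ..., 0) *)
Definition e1 (R : realType) (d : nat) : 'rV[R]_d :=
  \row_(i < d) (val i == 0%N)%:R.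

Definition cone (R : realType) (d : nat) (A : set 'rV[R]_d) : set 'rV[R]_d :=
  [set x | exists (n : nat) (a : 'I_n -> R) (v : 'I_n -> 'rV[R]_d),
     (forall i, 0 <= a i /\ A (v i)) /\ x = \sum_(i < n) a i *: v i].

Definition oppset (R : realType) (d : nat) (C : set 'rV[R]_d) : set 'rV[R]_d :=
  [set - x | x in C].

(* C^0 = C \cap (-C) *)
Definition lineality (R : realType) (d : nat) (C : set 'rV[R]_d) :
  set 'rV[R]_d := C `&` oppset C.

(* C^* *)
Definition dual_cone (R : realType) (d : nat) (C : set 'rV[R]_d) :
  set 'rV[R]_d := [set y | forall x, C x -> 0 <= dotv x y].

(* The minimum of A; it takes the junk value 0 when A has no minimum. *)
Definition set_min (R : realType) (A : set R) : R := xget 0 (A `&` lbound A).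

(* c_t(x), where C stands for the value of K_t: the least amount of the first
   asset from which x is attainable *)
Definition acquisition_cost (R : realType) (d : nat) (C : set 'rV[R]_d)
    (x : 'rV[R]_d) : R :=
  set_min [set c : R | C (c *: e1 R d - x)].

Record filtration (disp : measure_display) (Omega : measurableType disp)
    (T : nat) (F : 'I_T.+1 -> set (set Omega)) : Prop := Filtration {
  filtration_sigma_algebra : forall t, sigma_algebra [set: Omega] (F t) ;
  filtration_measurable : forall t, F t `<=` measurable ;
  filtration_mono : forall s t : 'I_T.+1, (s <= t)%N -> F s `<=` F t }.

(* Triviality up to null sets: F_0 = {set0, setT} is a particular case, but
   F_0 may also contain P-null sets. *)
Definition trivial_sigma_algebra (disp : measure_display)
    (Omega : measurableType disp) (R : realType) (P : probability Omega R)
    (G : set (set Omega)) : Prop :=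
  forall A, G A -> P A = 0%E \/ P A = 1%E.

Definition process (Omega : Type) (R : realType) (T d : nat) : Type :=
  'I_T.+1 -> Omega -> 'rV[R]_d.

(* L^0(R^d; F): X_t is measurable from (Omega, F_t) to R^d with its Borel
   sigma-algebra. *)
Definition adapted (disp : measure_display) (Omega : measurableType disp)
    (R : realType) (T d : nat) (F : 'I_T.+1 -> set (set Omega))
    (X : process Omega R T d) : Prop :=
  forall t, measurable_fun setT
    (X t : g_sigma_algebraType (F t) ->
           g_sigma_algebraType (@open 'rV[R]_d)).

Definition set_process (Omega : Type) (R : realType) (T d : nat) : Type :=
  'I_T.+1 -> Omega -> set 'rV[R]_d.

Definition C_valued (disp : measure_display) (Omega : measurableType disp)
    (R : realType) (P : probability Omega R) (T d : nat)
    (F : 'I_T.+1 -> set (set Omega)) (K : set_process Omega R T d) : Prop :=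
  exists X : nat -> process Omega R T d,
    (forall n, adapted F (X n)) /\
    forall t, {ae P, forall w,
      [/\ finite_set [set n | X n t w != 0],
          [set n | X n t w != 0] !=set0 &
          K t w = cone (range (fun n => X n t w))]}.

Definition calK (disp : measure_display) (Omega : measurableType disp)
    (R : realType) (P : probability Omega R) (T d : nat)
    (F : 'I_T.+1 -> set (set Omega)) : set (set_process Omega R T d) :=
  [set K | C_valued P F K /\
     forall t, {ae P, forall w,
       [set x : 'rV[R]_d | (forall i, 0 <= x 0 i) /\ x != 0]
         `<=` interior (K t w)}].

(* A(K) *)
Definition strategies (disp : measure_display) (Omega : measurableType disp)
    (R : realType) (P : probability Omega R) (T d : nat)
    (F : 'I_T.+1 -> set (set Omega)) (K : set_process Omega R T d) :
  set (process Omega R T d) :=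
  [set xi | adapted F xi /\
     forall t, {ae P, forall w, oppset (K t w) (xi t w)}].

(* V^{x, xi} *)
Definition wealth (Omega : Type) (R : realType) (T d : nat) (x : 'rV[R]_d)
    (xi : process Omega R T d) : process Omega R T d :=
  fun t w => x + \sum_(s < T.+1 | (s <= t)%N) xi s w.

(* A(x; K) *)
Definition attainable (disp : measure_display) (Omega : measurableType disp)
    (R : realType) (P : probability Omega R) (T d : nat)
    (F : 'I_T.+1 -> set (set Omega)) (x : 'rV[R]_d)
    (K : set_process Omega R T d) : set (process Omega R T d) :=
  [set wealth x xi | xi in strategies P F K].

(* A^s(x; K) *)
Definition superhedgeable (disp : measure_display)
    (Omega : measurableType disp) (R : realType) (P : probability Omega R)
    (T d : nat) (F : 'I_T.+1 -> set (set Omega)) (x : 'rV[R]_d)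
    (K : set_process Omega R T d) : set (process Omega R T d) :=
  [set theta | adapted F theta /\
     exists2 V, attainable P F x K V &
       forall t, {ae P, forall w, K t w (V t w - theta t w)}].

Definition Gamma (disp : measure_display) (Omega : measurableType disp)
    (R : realType) (P : probability Omega R) (T d : nat)
    (F : 'I_T.+1 -> set (set Omega)) (theta : process Omega R T d)
    (K : set_process Omega R T d) : set 'rV[R]_d :=
  [set x | superhedgeable P F x K theta].

(* The last clause is E[Z_t | F_s] = Z_s, coordinatewise, through the defining
   property of the conditional expectation. *)
Definition martingale (disp : measure_display) (Omega : measurableType disp)
    (R : realType) (P : probability Omega R) (T d : nat)
    (F : 'I_T.+1 -> set (set Omega)) (Z : process Omega R T d) : Prop :=
  [/\ adapted F Z,
      forall t i, P.-integrable setT (fun w => (Z t w 0 i)%:E) &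
      forall s t : 'I_T.+1, (s <= t)%N -> forall (A : set Omega) i, F s A ->
        (\int[P]_(w in A) (Z t w 0 i)%:E = \int[P]_(w in A) (Z s w 0 i)%:E)%E].

(* Z(K) *)
Definition calZ (disp : measure_display) (Omega : measurableType disp)
    (R : realType) (P : probability Omega R) (T d : nat)
    (F : 'I_T.+1 -> set (set Omega)) (K : set_process Omega R T d) :
  set (process Omega R T d) :=
  [set Z | martingale P F Z /\
     forall t, {ae P, forall w, dual_cone (K t w) (Z t w)}].

Definition stopping_time (Omega : Type) (T : nat)
    (F : 'I_T.+1 -> set (set Omega)) : set (Omega -> 'I_T.+1) :=
  [set tau | forall t, F t [set w | (tau w <= t)%N]].

(* The expectation is extended-real valued and equals E[Y^+] - E[Y^-], with the
   convention +oo - (+oo) = -oo. *)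
Definition Theta (disp : measure_display) (Omega : measurableType disp)
    (R : realType) (P : probability Omega R) (T d : nat)
    (F : 'I_T.+1 -> set (set Omega)) (theta : process Omega R T d)
    (K : set_process Omega R T d) : set 'rV[R]_d :=
  [set x | forall Z, calZ P F K Z ->
     (ereal_sup
        [set 'E_P[fun w => (dotv (Z (tau w) w) (theta (tau w) w)
                            - dotv (Z ord0 w) x)%R]
        | tau in stopping_time F] <= 0)%E].

(* Main.v *)
Require Import Defs.
From HB Require Import structures.
From mathcomp Require Import all_boot all_order all_algebra.
From mathcomp Require Import all_classical all_reals all_analysis.
From mathcomp Require Import measurable_realfun lra.

Set Implicit Arguments.
Unset Strict Implicit.
Unset Printing Implicit Defensive.

Import Order.TTheory GRing.Theory Num.Theory.
Import numFieldNormedType.Exports.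

Local Open Scope classical_set_scope.
Local Open Scope ring_scope.

(** Write [c] for the acquisition cost of [x] at time 0 and take the
    deterministic option paying [c *: e1] if exercised at time 0 and [x] at any
    later date.  The initial endowment [c *: e1] lies in [Theta] but not in
    [Gamma].

    It lies in [Theta]: the holder decides at time 0 between [c *: e1] and [x].
    For a martingale [Z], stopping after time 0 is worth
    [Z_0 . x] by optional stopping ([optional_stopping]), and
    [Z_0 . (c *: e1 - x) >= 0] because [c *: e1 - x] belongs to [K_0] and [Z_0]
    to its dual ([expectation_stopped_le0]).

    It does not lie in [Gamma]: the hedger has to cover both payoffs without
    knowing the choice.  Covering [c *: e1] at time 0 only allows a trade [a]
    with [a] and [- a] both in [K_0], after which the position is
    [y = c *: e1 + a]; covering [x] at time 1 needs [y - x] in [K_1] almost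
    surely.  By (i) this forces [x - y] into [K_0], whence
    [x - c *: e1 = (x - y) + a] is in [K_0], against (ii).

    Two facts are needed to run this argument.  The minimum that defines [c] has
    to be attained: finitely generated cones are finite intersections of
    half-spaces ([finitely_generated_halfspaces]), so that [c] is the largest
    of finitely many lower bounds ([acquisition_cost_attained]).  And [K_0] and
    the trade at time 0 have to be deterministic: a random vector measurable
    for a trivial sigma-algebra is almost surely constant
    ([trivial_ae_cst]). *)

(** * Finitely generated cones *)

Section Cones.
Variables (R : realType) (d : nat).
Implicit Types (u v x y z : 'rV[R]_d) (C A : set 'rV[R]_d) (s ys : seq 'rV[R]_d).

Lemma dotvC x y : dotv x y = dotv y x.
Proof. by apply: eq_bigr => i _; rewrite mulrC. Qed.

Lemma dotvDr x y z : dotv x (y + z) = dotv x y + dotv x z.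
Proof.
by rewrite /dotv -big_split; apply: eq_bigr => i _; rewrite mxE mulrDr.
Qed.

Lemma dotvZr (a : R) x y : dotv x (a *: y) = a * dotv x y.
Proof.
by rewrite /dotv mulr_sumr; apply: eq_bigr => i _; rewrite mxE mulrCA.
Qed.

Lemma dotv0 x : dotv x 0 = 0.
Proof. by rewrite -(scale0r 0) dotvZr mul0r. Qed.

Lemma dotvNr x y : dotv x (- y) = - dotv x y.
Proof. by rewrite -scaleN1r dotvZr mulN1r. Qed.

Lemma dotvBr x y z : dotv x (y - z) = dotv x y - dotv x z.
Proof. by rewrite dotvDr dotvNr. Qed.

Lemma dotvBl x y z : dotv (x - y) z = dotv x z - dotv y z.
Proof. by rewrite dotvC dotvBr !(dotvC z). Qed.

Lemma dotvZl (a : R) x y : dotv (a *: x) y = a * dotv x y.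
Proof. by rewrite dotvC dotvZr dotvC. Qed.

Lemma dotvNl x y : dotv (- x) y = - dotv x y.
Proof. by rewrite dotvC dotvNr dotvC. Qed.

Lemma dotv_delta (i : 'I_d) z : dotv (delta_mx 0 i) z = z 0 i.
Proof.
rewrite /dotv (bigD1 i) //= mxE !eqxx mul1r big1 ?addr0 // => j ji.
by rewrite mxE (negbTE ji) andbF mul0r.
Qed.

Definition convex_cone C : Prop :=
  [/\ C 0, forall x y, C x -> C y -> C (x + y) &
      forall (a : R) x, 0 <= a -> C x -> C (a *: x)].

Lemma convex_cone_cone A : convex_cone (cone A).
Proof.
split=> [|x y [n [a [v [av ->]]]] [m [b [w [bw ->]]]]|c x c0 [n [a [v [av ->]]]]].
- by exists 0%N, (fun=> 0), (fun=> 0); split=> [[]//|]; rewrite big_ord0.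
- exists (n + m)%N, (fun i : 'I_(n + m)%N => match fintype.split i with inl j => a j | inr j => b j end),
    (fun i : 'I_(n + m)%N => match fintype.split i with inl j => v j | inr j => w j end).
  split=> [i|]; first by case: (fintype.split i).
  rewrite big_split_ord; congr (_ + _); apply: eq_bigr => i _.
  + by rewrite (unsplitK (inl _ i)).
  + by rewrite (unsplitK (inr _ i)).
- exists n, (fun i => c * a i), v; split=> [i|].
    by have [? ?] := av i; split=> //; apply: mulr_ge0.
  by rewrite scaler_sumr; apply: eq_bigr => i _; rewrite scalerA.
Qed.

Lemma sub_cone A : A `<=` cone A.
Proof.
move=> x Ax; exists 1%N, (fun=> 1), (fun=> x); split=> //.
by rewrite big_ord1 scale1r.
Qed.

Lemma cone_sub A C : convex_cone C -> A `<=` C -> cone A `<=` C.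
Proof.
move=> [C0 CD CZ] AC x [n [a [v [av ->]]]].
elim/big_ind: _ => // i _; have [a0 Av] := av i.
by apply: CZ => //; apply: AC.
Qed.

Lemma eq_cone A B : A `<=` cone B -> B `<=` cone A -> cone A = cone B.
Proof.
by move=> AB BA; apply/seteqP; split; apply: cone_sub => //;
  apply: convex_cone_cone.
Qed.

Lemma convex_coneD C x y : convex_cone C -> C x -> C y -> C (x + y).
Proof. by case=> _ + _; apply. Qed.

(** Adjoining the generator [v] to [A]: the form in which [t] appears as a
    variable to be eliminated. *)
Lemma convex_cone_addl A v : convex_cone A ->
  convex_cone [set z | exists2 t : R, 0 <= t & A (z - t *: v)].
Proof.
move=> [A0 AD AZ]; split.
- by exists 0 => //; rewrite scale0r subr0.
- move=> x y [t t0 Ax] [r r0 Ay]; exists (t + r); first exact: addr_ge0.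
  by rewrite scalerDl opprD addrACA; apply: AD.
- move=> a x a0 [t t0 Ax]; exists (a * t); first exact: mulr_ge0.
  by rewrite -scalerA -scalerBr; apply: AZ.
Qed.

Lemma cone_consP v s z :
  cone [set` v :: s] z <-> exists2 t : R, 0 <= t & cone [set` s] (z - t *: v).
Proof.
have ccs := convex_cone_cone [set` s].
split=> [|[t t0 zs]].
- apply: (cone_sub (convex_cone_addl v ccs)) => y /=.
  rewrite inE => /orP[/eqP ->|ys].
    by exists 1 => //; rewrite scale1r subrr; case: ccs.
  by exists 0 => //; rewrite scale0r subr0; apply: sub_cone.
- have ccvs := convex_cone_cone [set` v :: s].
  rewrite -(subrK (t *: v) z); apply: convex_coneD => //.
    move: zs; apply: cone_sub => // y /= ys; apply: sub_cone => /=.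
    by rewrite inE ys orbT.
  by case: ccvs => _ _; apply=> //; apply: sub_cone; rewrite /= mem_head.
Qed.

Lemma seq_max (a : R) (s : seq R) :
  exists2 t, t \in a :: s & forall r, r \in a :: s -> r <= t.
Proof.
elim: s a => [|b s IH] a.
  by exists a => [|u]; rewrite ?mem_head // mem_seq1 => /eqP ->.
have [t ts tmax] := IH b; have [ta|/ltW at_] := leP t a.
- exists a; first exact: mem_head.
  move=> u; rewrite in_cons => /orP[/eqP ->//|/tmax ut]; exact: le_trans ta.
- exists t; first by rewrite in_cons ts orbT.
  by move=> u; rewrite in_cons => /orP[/eqP ->//|/tmax].
Qed.

Definition halfspaces ys : set 'rV[R]_d :=
  [set z | forall y, y \in ys -> 0 <= dotv y z].

(** One step of Fourier-Motzkin elimination: [t] can be eliminated because the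
    lower bounds that the half-spaces put on it (the [y] with [dotv y v < 0])
    have to lie below the upper bounds (the [y] with [0 < dotv y v]), which is
    one homogeneous inequality for each pair. *)
Lemma halfspaces_addl ys v : exists ys', forall z,
  (exists2 t : R, 0 <= t & halfspaces ys (z - t *: v)) <-> halfspaces ys' z.
Proof.
pose pos := [seq y <- ys | 0 <= dotv y v].
pose neg := [seq y <- ys | dotv y v < 0].
exists (pos ++ [seq dotv y1 v *: y2 - dotv y2 v *: y1 | y1 <- pos, y2 <- neg]).
move=> z; split=> [[t t0 zt] y|zys].
- have {}zt y' : y' \in ys -> t * dotv y' v <= dotv y' z.
    by move=> /zt; rewrite dotvBr dotvZr subr_ge0.
  rewrite mem_cat => /orP[|/allpairsP[[y1 y2] /= []]].
    rewrite mem_filter => /andP[yv /zt]; apply: le_trans; exact: mulr_ge0.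
  rewrite !mem_filter => /andP[y1v /zt z1] /andP[y2v /zt z2] ->.
  rewrite dotvBl !dotvZl.
  have : 0 <= dotv y1 v * (dotv y2 z - t * dotv y2 v).
    by rewrite mulr_ge0 // subr_ge0.
  have : 0 <= - dotv y2 v * (dotv y1 z - t * dotv y1 v).
    by rewrite mulr_ge0 ?subr_ge0 // oppr_ge0 ltW.
  lra.
- (* the least nonnegative t that respects every lower bound *)
  have [t tin tmax] := seq_max 0 [seq dotv y z / dotv y v | y <- neg].
  exists t; first by apply: tmax; rewrite mem_head.
  move=> y yys; rewrite dotvBr dotvZr subr_ge0.
  have [yv|yv] := ltP (dotv y v) 0.
    rewrite -ler_ndivrMr //; apply: tmax; rewrite in_cons.
    by apply/orP; right; apply/mapP; exists y; rewrite // mem_filter yv.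
  have ypos : y \in pos by rewrite mem_filter yv.
  move: tin; rewrite in_cons => /orP[/eqP ->|/mapP[y2 y2neg ->]].
    by rewrite mul0r; apply: zys; rewrite mem_cat ypos.
  have y2v : dotv y2 v < 0 by move: y2neg; rewrite mem_filter => /andP[].
  have /zys : dotv y v *: y2 - dotv y2 v *: y \in
     pos ++ [seq dotv y1 v *: y2 - dotv y2 v *: y1 | y1 <- pos, y2 <- neg].
    by rewrite mem_cat; apply/orP; right; apply/allpairsP; exists (y, y2).
  rewrite dotvBl !dotvZl subr_ge0 => le12.
  by rewrite mulrAC ler_ndivrMr // mulrC [leRHS]mulrC.
Qed.

(** The generators are adjoined one at a time to the zero cone, which is cut
    out by the half-spaces of plus and minus the unit vectors. *)
Lemma cone_halfspaces s : exists ys, cone [set` s] = halfspaces ys.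
Proof.
elim: s => [|v s [ys sys]].
  exists ([seq delta_mx 0 i | i <- enum 'I_d] ++
          [seq - delta_mx 0 i | i <- enum 'I_d]).
  apply/seteqP; split=> z.
    have -> : [set` [::]] = set0 :> set 'rV[R]_d by apply/seteqP; split.
    move=> [[|n] [a [v [av ->]]]]; last by have [] := av ord0.
    by move=> y _; rewrite big_ord0 dotv0.
  move=> zh; suff -> : z = 0 by case: (convex_cone_cone [set` ([::] : seq 'rV[R]_d)]).
  apply/rowP => i; rewrite mxE; apply/eqP; rewrite eq_le.
  apply/andP; split; last first.
    rewrite -dotv_delta; apply: zh; rewrite mem_cat.
    by rewrite map_f ?mem_enum.
  rewrite -oppr_ge0 -dotv_delta -dotvNl; apply: zh; rewrite mem_cat.
  by rewrite (map_f (fun i => - delta_mx 0 i)) ?mem_enum ?orbT.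
have [ys' ys'P] := halfspaces_addl ys v; exists ys'.
apply/seteqP; split=> z; rewrite -sys in ys'P.
  by move/cone_consP/ys'P.
by move/ys'P/cone_consP.
Qed.

(** Minkowski-Weyl: removing the zero generators leaves a finite list. *)
Lemma finitely_generated_halfspaces (X : nat -> 'rV[R]_d) :
  finite_set [set n | X n != 0] ->
  exists ys, cone (range X) = halfspaces ys.
Proof.
move=> /finite_seqP[ns nsE].
have [ys ysE] := cone_halfspaces [seq X n | n <- ns]; exists ys.
rewrite -ysE; apply: eq_cone => [_ [n _ <-]|_ /mapP[n _ ->]]; last first.
  by apply: sub_cone; exists n.
have [->|Xn] := eqVneq (X n) 0.
  by case: (convex_cone_cone [set` [seq X n | n <- ns]]).
apply: sub_cone => /=; apply: map_f.
have : [set n | X n != 0] n by [].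
by rewrite nsE.
Qed.

(** If [u] is interior to a proper polyhedral cone, no defining half-space
    contains [-u] unless it is the whole space, so that the inequalities
    [dotv y x <= c * dotv y u] bound [c] from below and the largest of these
    finitely many bounds is attained. *)
Lemma acquisition_cost_attained C x : (exists ys, C = halfspaces ys) ->
  interior C (e1 R d) -> (exists z, ~ C z) ->
  C (acquisition_cost C x *: e1 R d - x).
Proof.
move=> [ys ->] eint [z0 z0C]; set u := e1 R d in eint *.
have uint z : exists2 t : R, 0 < t & halfspaces ys (u + t *: z).
  have cvg0 : (fun t : R => u + t *: z) @ 0 --> u.
    rewrite -[X in _ --> X]addr0 -(scale0r z).
    apply: cvgD; first exact: cvg_cst.
    by apply: cvgZr_tmp; exact: cvg_id.
  have /cvg0/nbhs_ballP[e /= e0 eC] := eint.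
  exists (e / 2); first by rewrite divr_gt0.
  apply: eC; rewrite /ball /= sub0r normrN gtr0_norm ?divr_gt0 //.
  by rewrite ltr_pdivrMr // ltr_pMr // ltr1n.
have u0 y : y \in ys -> 0 <= dotv y u.
  exact: (interior_subset eint).
have uz y : y \in ys -> dotv y u = 0 -> forall z, 0 <= dotv y z.
  move=> yys yu z; have [t t0 /(_ y yys)] := uint z.
  by rewrite dotvDr yu add0r dotvZr pmulr_rge0.
pose bounds := [seq dotv y x / dotv y u | y <- ys & 0 < dotv y u].
have boundsP c : halfspaces ys (c *: u - x) <-> forall b, b \in bounds -> b <= c.
  split=> [cC _ /mapP[y + ->]|cb y yys].
    rewrite mem_filter => /andP[yu /cC]; rewrite dotvBr dotvZr subr_ge0.
    by rewrite ler_pdivrMr.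
  rewrite dotvBr dotvZr subr_ge0.
  have := u0 y yys; rewrite le_eqVlt => /orP[/eqP/esym yu|yu].
    have := uz y yys yu (- x); rewrite dotvNr oppr_ge0 => yx.
    by rewrite yu mulr0.
  rewrite -ler_pdivrMr //; apply: cb; apply/mapP; exists y => //.
  by rewrite mem_filter yu.
have [b bE] : exists b, bounds = b :: behead bounds.
  case boundsE : bounds => [|b bs]; last by exists b.
  case: z0C => y yys.
  have := u0 y yys; rewrite le_eqVlt => /orP[/eqP/esym yu|yu].
    exact: uz.
  suff : dotv y x / dotv y u \in bounds by rewrite boundsE.
  by apply/mapP; exists y => //; rewrite mem_filter yu.
have [c cb cmax] := seq_max b (behead bounds); rewrite -bE in cb cmax.
rewrite /acquisition_cost /set_min.
suff [] : ([set c | halfspaces ys (c *: u - x)] `&`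
           lbound [set c | halfspaces ys (c *: u - x)])
   (xget 0 ([set c | halfspaces ys (c *: u - x)] `&`
           lbound [set c | halfspaces ys (c *: u - x)])) by [].
apply: xgetPex; exists c; split=> /=; first exact/boundsP.
by move=> c' /boundsP; apply.
Qed.

End Cones.

(** * Random vectors measurable for a trivial sigma-algebra *)

Section Trivial.
Variables (R : realType) (disp : measure_display) (Omega : measurableType disp).
Variables (P : probability Omega R) (G : set (set Omega)).
Hypotheses (G_sigma : sigma_algebra [set: Omega] G).
Hypotheses (G_meas : G `<=` measurable).
Hypotheses (G_triv : trivial_sigma_algebra P G).

Lemma ae_ex (Q : Omega -> Prop) : {ae P, forall w, Q w} -> exists w, Q w.
Proof.
have PT : (0 < P [set: Omega])%E by rewrite probability_setT.
have PF := ae_properfilter_algebraOfSetsType PT.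
exact: filter_ex.
Qed.

Lemma trivial_event_ae (A : set Omega) : G A ->
  {ae P, forall w, A w <-> P A = 1%E}.
Proof.
move=> GA; have mA := G_meas GA; have [PA|PA] := G_triv GA.
- exists A; split=> // w /= nA; apply: contrapT => Aw; apply: nA; split=> //.
  by rewrite PA => /eqP; rewrite eq_sym onee_eq0.
- exists (~` A); split; first exact: measurableC.
    by rewrite probability_setC // PA subee.
  by move=> w /= nA Aw; apply: nA.
Qed.

(** Almost surely, each of the countably many events [f w 0 i < q] with [q]
    rational is decided by its probability, and they determine [f w]. *)
Lemma trivial_ae_cst (d : nat) (f : Omega -> 'rV[R]_d) :
  measurable_fun setT
    (f : g_sigma_algebraType G -> g_sigma_algebraType (@open 'rV[R]_d)) ->
  exists a, {ae P, forall w, f w = a}.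
Proof.
move=> mf; pose A (i : 'I_d) (q : rat) := [set w | f w 0 i < ratr q].
have GA i q : G (A i q).
  rewrite -(sigma_algebra_id G_sigma).
  have op : open [set v : 'rV[R]_d | v 0 i < ratr q].
    apply: (@open_comp _ _ (fun v : 'rV[R]_d => v 0 i) [set y | y < ratr q]).
      by move=> v _; exact: coord_continuous.
    exact: open_lt.
  have := mf measurableT _ (@sub_sigma_algebra _ setT (@open 'rV[R]_d) _ op).
  by rewrite setTI.
have decided : {ae P, forall w, forall n : nat,
    if unpickle n is Some (i, q) then A i q w <-> P (A i q) = 1%E else True}.
  apply: ae_foralln => n.
  case: (@unpickle ('I_d * rat)%type n) => [[i q]|]; last exact: aeW.
  exact: trivial_event_ae.
have [w0 h0] := ae_ex decided; exists (f w0).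
apply: filterS decided => w h; apply/rowP => i.
have same q : (f w 0 i < ratr q) <-> (f w0 0 i < ratr q).
  have := h (pickle (i, q)); have := h0 (pickle (i, q)).
  by rewrite pickleK /A /= => -> ->.
have [/rat_in_itvoo[q]|/rat_in_itvoo[q]|//] := ltgtP (f w 0 i) (f w0 0 i);
  rewrite in_itv /= => /andP[lt1 lt2].
- by move/same: lt1; rewrite ltNge (ltW lt2).
- by move/same: lt1; rewrite ltNge (ltW lt2).
Qed.

(** This is where completeness enters: an event of full outer probability need
    not otherwise be measurable, and its probability would be meaningless. *)
Lemma ae_probability1 (Q : set Omega) : measure_is_complete P ->
  {ae P, forall w, Q w} -> P Q = 1%E.
Proof.
move=> Pc PQ; have mQC := Pc _ PQ.
have mQ : measurable Q by rewrite -[Q]setCK; exact: measurableC.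
have /negligibleP := PQ => /(_ mQC) QC0.
by rewrite -[Q]setCK probability_setC //; rewrite QC0 sube0.
Qed.

End Trivial.

(** * Optional stopping *)

Section Stopping.
Variables (R : realType) (disp : measure_display) (Omega : measurableType disp).
Variables (P : probability Omega R) (T : nat).
Variables (F : 'I_T.+1 -> set (set Omega)).
Hypothesis F_filtration : filtration F.

Lemma filtrationE t : F t = @measurable _ (g_sigma_algebraType (F t)).
Proof.
by apply/esym/sigma_algebra_id/filtration_sigma_algebra.
Qed.

Lemma stopping_time_eq (tau : Omega -> 'I_T.+1) t : stopping_time F tau ->
  F t [set w | tau w = t].
Proof.
move=> tauF.
have -> : [set w | tau w = t] = [set w | (tau w <= t)%N] `&`
    \bigcap_(s in [set s : 'I_T.+1 | (s < t)%N]) ~` [set w | (tau w <= s)%N].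
  apply/seteqP; split=> w /=.
    move=> tw; split=> [|s /= st /= le_ts]; first by rewrite tw.
    by move: st; rewrite ltnNge -tw le_ts.
  move=> [le_t lt_t]; apply/val_inj/eqP; rewrite eqn_leq le_t leqNgt /=.
  by apply/negP => /lt_t /=; rewrite leqnn.
rewrite filtrationE.
apply: measurableI; first by rewrite -filtrationE; apply: tauF.
apply: fin_bigcap_measurable => [|s /= st]; first exact: finite_finset.
apply: measurableC; rewrite -filtrationE.
by apply: (filtration_mono F_filtration (ltnW st)); apply: tauF.
Qed.

Definition real_martingale (M : 'I_T.+1 -> Omega -> R) : Prop :=
  (forall t, P.-integrable setT (EFin \o M t)) /\
  forall s t : 'I_T.+1, (s <= t)%N -> forall A, F s A ->
    (\int[P]_(w in A) (M t w)%:E = \int[P]_(w in A) (M s w)%:E)%E.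

Section Stopped.
Variables (tau : Omega -> 'I_T.+1) (M : 'I_T.+1 -> Omega -> R).
Hypothesis (tau_stop : stopping_time F tau).
Hypothesis (M_int : forall t, P.-integrable setT (EFin \o M t)).

Let level t := [set w | tau w = t].

Let measurable_level t : measurable (level t).
Proof.
by apply: (filtration_measurable F_filtration); exact: stopping_time_eq.
Qed.

Let stopped_sum : (fun w => (M (tau w) w)%:E) =
  (fun w => \sum_(t < T.+1) ((EFin \o M t) \_ (level t)) w)%E.
Proof.
apply/funext => w; rewrite (bigD1 (tau w)) //= big1 ?adde0.
  by rewrite patchE mem_set.
by move=> t tw; rewrite patchE memNset // /level /= => /esym/eqP; exact/negP.
Qed.

Let integrable_level t : P.-integrable setT ((EFin \o M t) \_ (level t)).
Proof.
apply/(integrable_mkcond _ (measurable_level t)).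
exact: integrableS (M_int t).
Qed.

Lemma integrable_stopped : P.-integrable setT (fun w => (M (tau w) w)%:E).
Proof.
by rewrite stopped_sum; apply: integrable_sum => // t _; exact: integrable_level.
Qed.

Lemma integral_stopped A : measurable A ->
  (\int[P]_(w in A) (M (tau w) w)%:E =
   \sum_(t < T.+1) \int[P]_(w in A `&` [set w | tau w = t]) (M t w)%:E)%E.
Proof.
move=> mA; rewrite stopped_sum integral_sum //.
  by apply: eq_bigr => t _; rewrite integral_mkcondr.
by move=> t; apply: integrableS (integrable_level t).
Qed.

End Stopped.

(** On the event that [tau = t], the martingale at time [t] can be replaced by
    its terminal value, which no longer depends on [t]. *)
Lemma optional_stopping (tau : Omega -> 'I_T.+1) (M : 'I_T.+1 -> Omega -> R) A :
  stopping_time F tau -> real_martingale M -> F ord0 A ->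
  (\int[P]_(w in A) (M (tau w) w)%:E = \int[P]_(w in A) (M ord0 w)%:E)%E.
Proof.
move=> tauF [Mint Mmart] FA.
have mA := filtration_measurable F_filtration FA.
rewrite -(Mmart _ ord_max _ _ FA) // integral_stopped //.
rewrite (integral_stopped (M := fun=> M ord_max) tauF) //.
apply: eq_bigr => t _; rewrite (Mmart t ord_max) ?leq_ord // filtrationE.
apply: measurableI; rewrite -filtrationE; last exact: stopping_time_eq.
exact: (@filtration_mono _ _ _ _ F_filtration ord0 t).
Qed.

Lemma real_martingale_dotv (d : nat) (Z : process Omega R T d) x :
  martingale P F Z -> real_martingale (fun t w => dotv (Z t w) x).
Proof.
move=> [_ Zint Zmart].
have E t : EFin \o (fun w => dotv (Z t w) x) =
    (fun w => \sum_(i < d) ((x 0 i)%:E * (Z t w 0 i)%:E)%E).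
  apply/funext => w /=; rewrite /dotv -sumEFin; apply: eq_bigr => i _.
  by rewrite mulrC EFinM.
have int_i t i : P.-integrable setT (fun w => ((x 0 i)%:E * (Z t w 0 i)%:E)%E).
  by apply: integrableZl => //; exact: Zint.
split=> [t|s t st A FA].
  by rewrite E; apply: integrable_sum => // i _; exact: int_i.
have mA := filtration_measurable F_filtration FA.
have Eint r : (\int[P]_(w in A) (dotv (Z r w) x)%:E =
    \sum_(i < d) (x 0 i)%:E * \int[P]_(w in A) (Z r w 0 i)%:E)%E.
  transitivity (\int[P]_(w in A)
      \sum_(i < d) ((x 0 i)%:E * (Z r w 0 i)%:E)%E)%E.
    by apply: eq_integral => w _; exact: (congr1 (fun f => f w) (E r)).
  rewrite integral_sum //; last first.
    by move=> i; apply: integrableS (int_i r i).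
  by apply: eq_bigr => i _; rewrite integralZl //; apply: integrableS (Zint r i).
by rewrite !Eint; apply: eq_bigr => i _; rewrite (Zmart s t).
Qed.

Lemma ae_integral_ge0 (A : set Omega) (f : Omega -> \bar R) :
  measurable A -> measurable_fun A f ->
  {ae P, forall w, (0 <= f w)%E} -> (0 <= \int[P]_(w in A) f w)%E.
Proof.
move=> mA mf f0.
rewrite (ae_eq_integral (abse \o f)) //.
- by apply: integral_ge0 => w _; exact: abse_ge0.
- exact: measurableT_comp.
- by apply: filterS f0 => w /gee0_abs /= -> _.
Qed.

(** The integrand vanishes when [tau = 0]; elsewhere optional stopping replaces
    [Z_tau] by [Z_0], whatever the law of [tau] at later times. *)
Lemma expectation_stopped_le0 (d : nat) (Z : process Omega R T d) tau
    (a b : 'rV[R]_d) :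
  martingale P F Z -> stopping_time F tau ->
  {ae P, forall w, 0 <= dotv (Z ord0 w) (a - b)} ->
  ('E_P[fun w => (dotv (Z (tau w) w) (if tau w == ord0 then a else b)
                  - dotv (Z ord0 w) a)%R] <= 0)%E.
Proof.
move=> Zmart tauF Zab.
have Mb := real_martingale_dotv b Zmart.
have [Maint _] := real_martingale_dotv a Zmart.
have [Mabint _] := real_martingale_dotv (a - b) Zmart.
set B := ~` [set w | tau w = ord0].
have FB : F ord0 B.
  by rewrite filtrationE; apply: measurableC; rewrite -filtrationE;
    exact: stopping_time_eq.
have mB := filtration_measurable F_filtration FB.
rewrite unlock.
have -> : (\int[P]_w (dotv (Z (tau w) w) (if tau w == ord0 then a else b)
                  - dotv (Z ord0 w) a)%:E =
   \int[P]_(w in B) ((dotv (Z (tau w) w) b)%:E - (dotv (Z ord0 w) a)%:E))%E.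
  rewrite [RHS]integral_mkcond; apply: eq_integral => w _; rewrite patchE.
  have [tw|tw] := eqVneq (tau w) ord0.
    by rewrite memNset ?tw ?subrr // /B /= tw => /(_ erefl).
  by rewrite mem_set ?EFinB // /B /=; exact/eqP.
rewrite integralB //; last 2 first.
- by apply: integrableS (integrable_stopped tauF Mb.1).
- by apply: integrableS (Maint ord0).
rewrite (optional_stopping (M := fun t w => dotv (Z t w) b) tauF Mb FB).
rewrite -integralB //; last 2 first.
- by apply: integrableS (Mb.1 ord0).
- by apply: integrableS (Maint ord0).
rewrite (eq_integral (fun w => (-1)%:E * (dotv (Z ord0 w) (a - b))%:E)%E); last first.
  by move=> w _; rewrite -EFinB -EFinM dotvBr mulN1r opprB.
rewrite integralZl //; last by apply: integrableS (Mabint ord0).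
rewrite mulN1e oppe_le0; apply: ae_integral_ge0 => //.
by apply: (@measurable_funS _ _ _ _ setT) => //; case/integrableP: (Mabint ord0).
Qed.

End Stopping.

(** * The option that separates the two sets *)

(** Each of the countably many generators is almost surely constant at time 0,
    so almost surely they are all constant together. *)
Lemma trivial_C_valued_cst (R : realType) (disp : measure_display)
    (Omega : measurableType disp) (P : probability Omega R) (T d : nat)
    (F : 'I_T.+1 -> set (set Omega)) (K : set_process Omega R T d) :
  filtration F -> trivial_sigma_algebra P (F ord0) -> C_valued P F K ->
  exists C : set 'rV[R]_d, [/\ convex_cone C, exists ys, C = halfspaces ys &
    {ae P, forall w, K ord0 w = C}].
Proof.
move=> FF F0 [X [Xad /(_ ord0) XK]].
have /choice[a aX] n : exists a, {ae P, forall w, X n ord0 w = a}.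
  exact: (trivial_ae_cst (filtration_sigma_algebra FF ord0)
    (@filtration_measurable _ _ _ _ FF ord0) F0 (Xad n ord0)).
have {}aX := ae_foralln aX.
have fin : finite_set [set n | a n != 0].
  have [w [aw [+ _ _]]] := ae_ex (filterI aX XK).
  by congr finite_set; apply/funext => n /=; rewrite aw.
exists (cone (range a)); split; first exact: convex_cone_cone.
  exact: finitely_generated_halfspaces.
apply: filterS2 aX XK => w aw [_ _ ->].
by rewrite (_ : (fun n => X n ord0 w) = a) //; apply/funext => n.
Qed.

Lemma adapted_deterministic (R : realType) (disp : measure_display)
    (Omega : measurableType disp) (T d : nat)
    (F : 'I_T.+1 -> set (set Omega)) (f : 'I_T.+1 -> 'rV[R]_d) :
  adapted F (fun t (_ : Omega) => f t).
Proof. by move=> t; exact: measurable_cst. Qed.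

Theorem mainTheorem6 (R : realType) (disp : measure_display)
    (Omega : measurableType disp) (P : probability Omega R)
    (P_complete : measure_is_complete P)
    (T : nat) (T_ge1 : (1 <= T)%N) (d : nat) (d_ge1 : (1 <= d)%N)
    (F : 'I_T.+1 -> set (set Omega)) (F_filtration : filtration F)
    (F_T : F ord_max = measurable)
    (F_0 : trivial_sigma_algebra P (F ord0))
    (K : 'I_T.+1 -> Omega -> set 'rV[R]_d) (K_calK : calK P F K) :
  (exists x : 'rV[R]_d,
     (forall y : 'rV[R]_d,
        {ae P, forall w, lineality (K ord0 w)
                           (y - acquisition_cost (K ord0 w) x *: e1 R d)} ->
        {ae P, forall w, lineality (K ord0 w) (y - x)} \/
        (P [set w | K (inord 1) w (y - x)%R] < 1)%E) /\
     {ae P, forall w,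
        ~ K ord0 w (x - acquisition_cost (K ord0 w) x *: e1 R d)}) ->
  exists theta : 'I_T.+1 -> Omega -> 'rV[R]_d,
    adapted F theta /\ Theta P F theta K <> Gamma P F theta K.
Proof.
move=> [x [hyp_i hyp_ii]]; have [K_C K_int] := K_calK.
have [C [C_cone C_half K0C]] := trivial_C_valued_cst F_filtration F_0 K_C.
set c := acquisition_cost C x.
have xc_notin : ~ C (x - c *: e1 R d).
  by have [w [+ Kw]] := ae_ex (filterI hyp_ii K0C); rewrite Kw.
have cx_in : C (c *: e1 R d - x).
  apply: acquisition_cost_attained => //; last by exists (x - c *: e1 R d).
  have [w [Kint Kw]] := ae_ex (filterI (K_int ord0) K0C); rewrite -Kw.
  apply: Kint; split=> [i|]; first by rewrite mxE ler0n.
  apply/eqP => /rowP/(_ (Ordinal d_ge1)); rewrite !mxE eqxx => /eqP.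
  by rewrite oner_eq0.
pose theta (t : 'I_T.+1) (_ : Omega) := if t == ord0 then c *: e1 R d else x.
exists theta; split; first exact: adapted_deterministic.
suff [c_Theta c_Gamma] : Theta P F theta K (c *: e1 R d) /\
    ~ Gamma P F theta K (c *: e1 R d) by move=> E; rewrite E in c_Theta.
split.
  move=> Z [Zmart Zdual]; apply: ge_ereal_sup => _ [tau tauF <-].
  apply: (expectation_stopped_le0 F_filtration Zmart tauF).
  by apply: filterS2 (Zdual ord0) K0C => w + Kw; rewrite Kw dotvC; apply.
move=> [_ [_ [xi [xi_ad xi_K] <-] super]].
have [a xi0a] := trivial_ae_cst (filtration_sigma_algebra F_filtration ord0)
  (@filtration_measurable _ _ _ _ F_filtration ord0) F_0 (xi_ad ord0).
have wealth0 w : wealth (c *: e1 R d) xi ord0 w = c *: e1 R d + xi ord0 w.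
  rewrite /wealth (bigD1 ord0) //= big1 ?addr0 // => s.
  by rewrite leqn0 -val_eqE /= => /andP[/eqP->].
(* The wealth covers the time-0 payoff only if the first trade is reversible. *)
have lin_a : C a /\ C (- a).
  have [w [[[s0 xiK] xia] Kw]] :=
    ae_ex (filterI (filterI (filterI (super ord0) (xi_K ord0)) xi0a) K0C).
  split.
    by move: s0; rewrite wealth0 /theta eqxx xia Kw addrAC subrr add0r.
  by move: xiK; rewrite xia Kw => -[b Cb <-]; rewrite opprK.
have lin_y : {ae P, forall w, lineality (K ord0 w)
    (c *: e1 R d + a - acquisition_cost (K ord0 w) x *: e1 R d)}.
  apply: filterS K0C => w ->; rewrite addrAC subrr add0r.
  by split; [exact: lin_a.1|exists (- a); [exact: lin_a.2|exact: opprK]].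
(* The case of probability less than 1 is excluded because the time-1 position
   y + xi_1 covers x, and - xi_1 is in K_1, so that y - x is in K_1. *)
case: (hyp_i _ lin_y) => [lin_yx|]; last first.
  rewrite (ae_probability1 P_complete) ?ltxx //.
  have [X [_ /(_ (inord 1)) XK]] := K_C.
  have one_neq0 : inord 1 != ord0 :> 'I_T.+1.
    by rewrite -val_eqE /= inordK.
  have wealth1 w : wealth (c *: e1 R d) xi (inord 1) w =
      c *: e1 R d + xi ord0 w + xi (inord 1) w.
    rewrite /wealth (bigD1 ord0) //= (bigD1 (inord 1)) /=; last first.
      by rewrite one_neq0 leqnn.
    rewrite big1 ?addr0 ?addrA // => s /andP[/andP[s1 s0] sn1].
    move: s1 s0 sn1; rewrite inordK // -!val_eqE /= inordK //.
    by case: (nat_of_ord s) => [|[|]].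
  move: (super (inord 1)) (xi_K (inord 1)); rewrite /theta (negbTE one_neq0).
  move=> s1 xi1; apply: filterS2 (filterI s1 xi1) (filterI xi0a XK).
  move=> w [+ [b Kb bE]] [xia [_ _ KE]]; rewrite wealth1 xia -bE => Kyb.
  rewrite /= -(subrK b (c *: e1 R d + a)) addrAC; rewrite KE in Kyb Kb *.
  by apply: convex_coneD; [exact: convex_cone_cone|..].
have [w [[_ [b Cb bE]] Kw]] := ae_ex (filterI lin_yx K0C).
apply: xc_notin; rewrite Kw in Cb.
have -> : x - c *: e1 R d = b + a.
  by rewrite -[b]opprK bE opprB opprD addrA subrK.
by apply: convex_coneD => //; exact: lin_a.1.
Qed.
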